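(* Let $T:V\to A$ be a relative Rota-Baxter operator on a left pre-Jacobi-Jordan algebra $(A,\cdot)$ with respect to a representation $(V;\rho,\mu)$. If a linear map $J:V\to A$ generates a linear deformation of $T$, then the product $\omega_J$ on $V$ defined by $$\omega_J(u,v)=\rho(Ju)v+\mu(Jv)u,\quad\forall u,v\in V,$$ generates a linear deformation of the left pre-Jacobi-Jordan algebra $(V,\cdot_T)$.
   Context: All vector spaces are finite dimensional over a field $\mathbb{K}$ of characteristic $0$; an algebra is a vector space with a bilinear product, not assumed associative. A left pre-Jacobi-Jordan algebra is an algebra $(A,\cdot)$ whose anti-associator $Aasso(x,y,z):=(x\cdot y)\cdot z+x\cdot(y\cdot z)$ satisfies $Aasso(x,y,z)=-Aasso(y,x,z)$. A representation $(V;\rho,\mu)$ of $(A,\cdot)$ is a vector space $V$ with linear maps $\rho,\mu:A\to gl(V)$ such that for all $x,y\in A$ $$\rho(x\cdot y+y\cdot x)=-\rho(x)\rho(y)-\rho(y)\rho(x),\qquad \mu(y)\mu(x)+\mu(x\cdot y)=-\mu(y)\rho(x)-\rho(x)\mu(y).$$ A linear map $T:V\to A$ is a relative Rota-Baxter operator with respect to $(V;\rho,\mu)$ if $T(u)\cdot T(v)=T(\rho(Tu)v+\mu(Tv)u)$ for all $u,v\in V$; in that case $(V,\cdot_T)$ with $u\cdot_T v:=\rho(Tu)v+\mu(Tv)u$ is a left pre-Jacobi-Jordan algebra. A linear map $J:V\to A$ generates a linear deformation of $T$ if $T+tJ$ is a relative Rota-Baxter operator with respect to $(V;\rho,\mu)$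 for all $t\in\mathbb{K}$. A bilinear product $\omega$ on $V$ generates a linear deformation of a left pre-Jacobi-Jordan algebra $(V,\cdot_T)$ if $V$ with the product $(u,v)\mapsto u\cdot_T v+t\,\omega(u,v)$ is a left pre-Jacobi-Jordan algebra for all $t\in\mathbb{K}$. *)

(* Defs.v *)
From HB Require Import structures.
From mathcomp Require Import all_boot all_order all_algebra.

Set Implicit Arguments.
Unset Strict Implicit.
Unset Printing Implicit Defensive.

Import GRing.Theory.
Local Open Scope ring_scope.

Definition is_bilinear (K : fieldType) (A : vectType K) (m : A -> A -> A) :
  Prop := bilinear_for *:%R *:%R m.

Definition anti_associator (K : fieldType) (A : vectType K)
    (m : A -> A -> A) (x y z : A) : A :=
  m (m x y) z + m x (m y z).

Definition left_pre_Jacobi_Jordan (K : fieldType) (A : vectType K)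
    (m : A -> A -> A) : Prop :=
  is_bilinear m /\
  forall x y z : A, anti_associator m x y z = - anti_associator m y x z.

Definition is_representation (K : fieldType) (A : vectType K)
    (m : A -> A -> A) (V : vectType K) (rho mu : 'Hom(A, 'End(V))) : Prop :=
  (forall x y : A,
     rho (m x y + m y x) = - (rho x \o rho y)%VF - (rho y \o rho x)%VF) /\
  (forall x y : A,
     (mu y \o mu x)%VF + mu (m x y)
       = - (mu y \o rho x)%VF - (rho x \o mu y)%VF).

(* The product u ._T v on V. *)
Definition induced_product (K : fieldType) (A V : vectType K)
    (rho mu : 'Hom(A, 'End(V))) (T : 'Hom(V, A)) (u v : V) : V :=
  rho (T u) v + mu (T v) u.

Definition relative_Rota_Baxter (K : fieldType) (A : vectType K)
    (m : A -> A -> A) (V : vectType K) (rho mu : 'Hom(A, 'End(V)))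
    (T : 'Hom(V, A)) : Prop :=
  forall u v : V, m (T u) (T v) = T (rho (T u) v + mu (T v) u).

Definition generates_operator_deformation (K : fieldType) (A : vectType K)
    (m : A -> A -> A) (V : vectType K) (rho mu : 'Hom(A, 'End(V)))
    (T J : 'Hom(V, A)) : Prop :=
  forall t : K, relative_Rota_Baxter m rho mu (T + t *: J).

Definition generates_product_deformation (K : fieldType) (V : vectType K)
    (m omega : V -> V -> V) : Prop :=
  is_bilinear omega /\
  forall t : K, left_pre_Jacobi_Jordan (fun u v => m u v + t *: omega u v).

(* Main.v *)
(* The product induced by T + tJ is u ._T v + t omega_J(u, v), because the
   induced product is linear in the operator. So it suffices that every
   relative Rota-Baxter operator induces a left pre-Jacobi-Jordan product:
   after replacing T(u ._T v) by Tu . Tv, the first axiom of a representation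
   cancels the terms in w of the symmetrized anti-associator of (u, v, w), and
   the second axiom cancels those in u and those in v. *)
Require Import Defs.
From HB Require Import structures.
From mathcomp Require Import all_boot all_order all_algebra.

Set Implicit Arguments.
Unset Strict Implicit.
Unset Printing Implicit Defensive.

Import GRing.Theory.
Local Open Scope ring_scope.

(** Replaces functional extensionality: the deformed product and the product induced by [T + t *: J]
    are only shown equal pointwise. *)
Lemma left_pre_Jacobi_Jordan_ext (K : fieldType) (V : vectType K)
    (m m' : V -> V -> V) :
  m =2 m' -> left_pre_Jacobi_Jordan m -> left_pre_Jacobi_Jordan m'.
Proof.
move=> eqm [[linl linr] pJJ]; split; first split.
- by move=> v a x y; rewrite -!eqm; apply: linl.
- by move=> u a x y; rewrite -!eqm; apply: linr.
- by move=> x y z; have := pJJ x y z; rewrite /anti_associator !eqm.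
Qed.

Section InducedProduct.

Variables (K : fieldType) (A V : vectType K) (m : A -> A -> A).
Variables rho mu : 'Hom(A, 'End(V)).

Lemma induced_product_bilinear (T : 'Hom(V, A)) :
  is_bilinear (induced_product rho mu T).
Proof.
split=> [v a x y|u a x y]; rewrite /induced_product /= !linearP /=;
  by rewrite !(add_lfunE, scale_lfunE) addrACA -scalerDr.
Qed.

Lemma induced_productDZ (T J : 'Hom(V, A)) (t : K) (u v : V) :
  induced_product rho mu (T + t *: J) u v =
  induced_product rho mu T u v + t *: induced_product rho mu J u v.
Proof.
rewrite /induced_product !(add_lfunE, scale_lfunE) !linearD !linearZ /=.
by rewrite !(add_lfunE, scale_lfunE) addrACA.
Qed.

Lemma induced_product_left_pre_Jacobi_Jordan (T : 'Hom(V, A)) :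
  is_representation m rho mu -> relative_Rota_Baxter m rho mu T ->
  left_pre_Jacobi_Jordan (induced_product rho mu T).
Proof.
move=> [rhoP muP] rbT; split; first exact: induced_product_bilinear.
move=> u v w; rewrite /anti_associator /induced_product -!rbT.
have rho_w : rho (m (T u) (T v)) w + rho (m (T v) (T u)) w
    + (rho (T u) (rho (T v) w) + rho (T v) (rho (T u) w)) = 0.
  have /lfunP/(_ w) := rhoP (T u) (T v).
  rewrite linearD !(add_lfunE, opp_lfunE, comp_lfunE) => ->.
  by rewrite -opprD addNr.
(* Used at (u, w, v) for the terms in v and at (v, w, u) for those in u. *)
have mu_l x y z : mu (T y) (mu (T x) z) + mu (m (T x) (T y)) z
    + (mu (T y) (rho (T x) z) + rho (T x) (mu (T y) z)) = 0.
  have /lfunP/(_ z) := muP (T x) (T y).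
  rewrite !(add_lfunE, opp_lfunE, comp_lfunE) => ->.
  by rewrite -opprD addNr.
apply/eqP; rewrite -addr_eq0 !linearD /= !addrA.
(* Summands 1-6 come from the triple (u, v, w), and 7-12 are the same with u and v exchanged; the
   three groups collect the terms in w, v and u. *)
rewrite (ACl ((1*7*(4*10)) * ((9*12)*(2*5)) * ((3*6)*(8*11))))%AC /=.
by rewrite rho_w !mu_l !addr0.
Qed.

End InducedProduct.

Theorem proposition4p16 (K : fieldType) (charK0 : [pchar K] =i pred0)
    (A V : vectType K) (m : A -> A -> A) (rho mu : 'Hom(A, 'End(V)))
    (T J : 'Hom(V, A)) :
  left_pre_Jacobi_Jordan m ->
  is_representation m rho mu ->
  relative_Rota_Baxter m rho mu T ->
  generates_operator_deformation m rho mu T J ->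
  generates_product_deformation
    (induced_product rho mu T)
    (fun u v : V => rho (J u) v + mu (J v) u).
Proof.
(* The product omega_J is convertible to [induced_product rho mu J]. *)
move=> _ repr _ rbTJ; split; first exact: induced_product_bilinear.
move=> t; have := induced_product_left_pre_Jacobi_Jordan repr (rbTJ t).
exact/left_pre_Jacobi_Jordan_ext/induced_productDZ.
Qed.
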